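(* Let $m\geqslant 1$ be an integer, let $c_1,\ldots,c_m,\lambda\in\mathbb{C}$, let $B\in\mathbb{R}$, and let $Q\in\mathbb{C}[X]$ be a non-constant polynomial. Then there is a constant $C>0$, depending only on $Q$, $m$, $c_1,\ldots,c_m$, $\lambda$ and $B$, such that for every $N\geqslant 2$ the number of positive integers $n\leqslant N$ for which there exist integers $k_1,\ldots,k_m\in\mathbb{Z}$ with $$\left|Q(n)-\sum_{i=1}^m c_i\lambda^{k_i}\right|\leqslant B$$ is at most $C(\log N)^m$. *)

(* Defs.v *)
From HB Require Import structures.
From mathcomp Require Import all_boot all_order all_algebra.
From mathcomp Require Import finmap.
From mathcomp Require Import complex.
From mathcomp Require Import all_classical all_reals all_analysis.

Set Implicit Arguments.
Unset Strict Implicit.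
Unset Printing Implicit Defensive.

Import Order.TTheory GRing.Theory Num.Theory.

Local Open Scope ring_scope.
Local Open Scope complex_scope.
Local Open Scope classical_set_scope.

(* [lambda ^ k i] is the integer power.  For lambda = 0 the library convention
   is 0 ^ k = 0 for every k <> 0 and 0 ^ 0 = 1, so negative exponents add no
   value that nonnegative exponents do not already give. *)
Definition near_power_sum (R : realType) (m : nat) (c : 'I_m -> R[i])
    (lambda : R[i]) (B : R) (Q : {poly R[i]}) (n : nat) : Prop :=
  exists k : 'I_m -> int,
    `|Q.[n%:R] - \sum_(i < m) c i * lambda ^ k i| <= B%:C.

Definition near_power_sum_upto (R : realType) (m : nat) (c : 'I_m -> R[i])
    (lambda : R[i]) (B : R) (Q : {poly R[i]}) (N : R) : set nat :=
  [set n : nat | [/\ (0 < n)%N, n%:R <= N & near_power_sum c lambda B Q n]].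

(* [fset_set] is only meaningful on finite sets. *)
Lemma finite_near_power_sum_upto (R : realType) (m : nat) (c : 'I_m -> R[i])
    (lambda : R[i]) (B : R) (Q : {poly R[i]}) (N : R) :
  finite_set (near_power_sum_upto c lambda B Q N).
Proof.
apply: (@sub_finite_set _ _ `I_(Num.truncn N).+1); last exact: finite_II.
move=> n [_ nN _] /=; rewrite -(ltr_nat R).
exact: le_lt_trans nN (truncnS_gt N).
Qed.

Definition near_power_sum_count (R : realType) (m : nat) (c : 'I_m -> R[i])
    (lambda : R[i]) (B : R) (Q : {poly R[i]}) (N : R) : nat :=
  #|` fset_set (near_power_sum_upto c lambda B Q N)|.

(* Main.v *)
(** Assume |lambda| > 1. For any exponents k, some vanishing subsum of
  sum_i c_i lambda^(k_i) can be discarded so that each remaining term has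
  |lambda|^(k_i) at most a constant times the modulus of the whole sum:
  the terms within a bounded distance of the largest exponent form
  lambda^K times one of finitely many values, which either vanishes or
  dominates all the other terms. When the sum is within B of Q(n) with n <= N,
  the remaining exponents are therefore O(log N); the negative ones contribute
  O(1), so Q(n) lies within O(1) of one of O((log N)^m) numbers. Since
  Re (Q / lead_coef Q) eventually increases by at least 1/2 at each step, each
  such number is approached by a bounded number of n. The case |lambda| < 1
  follows by inverting lambda; if |lambda| = 1 or lambda = 0 the sums are
  bounded. *)
Require Import Defs.
From HB Require Import structures.
From mathcomp Require Import all_boot all_order all_algebra.
From mathcomp Require Import finmap.
From mathcomp Require Import complex.
From mathcomp Require Import all_classical all_reals all_analysis.
From mathcomp Require Import zify ring lra.

Set Implicit Arguments.
Unset Strict Implicit.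
Unset Printing Implicit Defensive.

Import Order.TTheory GRing.Theory Num.Theory.

Local Open Scope ring_scope.

(** * The complex modulus as a real number *)

Section ComplexModulus.
Variable R : realType.
Implicit Types z w : R[i].

(** The norm on [R[i]] is itself [R[i]]-valued; its real part is taken so that real order lemmas,
    [ln], [lra] and [nra] apply. *)
Definition cabs z : R := complex.Re `|z|.

Lemma cabsE z : `|z| = (cabs z)%:C%C.
Proof. by rewrite /cabs RRe_real// normr_real. Qed.

Lemma cabs_le z (b : R) : (`|z| <= b%:C%C) = (cabs z <= b).
Proof. by rewrite cabsE lecR. Qed.

Lemma cabs_ge0 z : 0 <= cabs z.
Proof. by rewrite -lecR -cabsE normr_ge0. Qed.

Lemma cabs0 : cabs 0 = 0.
Proof. by rewrite /cabs normr0. Qed.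

Lemma cabs_gt0 z : (0 < cabs z) = (z != 0).
Proof. by rewrite -ltcR -cabsE normr_gt0. Qed.

Lemma cabs1 : cabs 1 = 1.
Proof. by rewrite /cabs normr1. Qed.

Lemma cabsM z w : cabs (z * w) = cabs z * cabs w.
Proof.
by apply: (@complexI R); rewrite rmorphM -!cabsE normrM.
Qed.

Lemma cabsV z : cabs z^-1 = (cabs z)^-1.
Proof.
by apply: (@complexI R); rewrite fmorphV -!cabsE normfV.
Qed.

Lemma cabsX z n : cabs (z ^+ n) = cabs z ^+ n.
Proof. by apply: (@complexI R); rewrite rmorphXn -!cabsE normrX. Qed.

Lemma cabsXz z (k : int) : cabs (z ^ k) = cabs z ^ k.
Proof. by case: k => n; rewrite ?NegzE -?exprnN -?exprnP ?cabsV cabsX. Qed.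

Lemma cabsD z w : cabs (z + w) <= cabs z + cabs w.
Proof. by rewrite -lecR rmorphD -!cabsE ler_normD. Qed.

Lemma cabsN z : cabs (- z) = cabs z.
Proof. by rewrite /cabs normrN. Qed.

Lemma cabsB z w : cabs (z - w) <= cabs z + cabs w.
Proof. by rewrite -[cabs w]cabsN cabsD. Qed.

Lemma cabs_sum (I : Type) (r : seq I) (P : pred I) (F : I -> R[i]) :
  cabs (\sum_(i <- r | P i) F i) <= \sum_(i <- r | P i) cabs (F i).
Proof.
elim/big_ind2: _ => [|z a w b za wb|//]; first by rewrite cabs0.
by rewrite (le_trans (cabsD _ _))// lerD.
Qed.

Lemma cabs_nat n : cabs n%:R = n%:R.
Proof. by apply: (@complexI R); rewrite -cabsE normr_nat rmorph_nat. Qed.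

Lemma Re_le_cabs z : complex.Re z <= cabs z.
Proof.
by rewrite (le_trans (ler_norm _))// -lecR -cabsE normc_ge_Re.
Qed.

Lemma ReD z w : complex.Re (z + w) = complex.Re z + complex.Re w.
Proof. by case: z w => [a b] [c d]. Qed.

Lemma Re_natM n z : complex.Re (n%:R * z) = n%:R * complex.Re z.
Proof.
have -> : (n%:R : R[i]) = (n%:R : R)%:C%C by rewrite rmorph_nat.
by case: z => [a b] /=; rewrite mul0r subr0.
Qed.

End ComplexModulus.

(** * Uniform constants and growth of powers *)

Section Bounds.
Variable R : realType.

Lemma uniform_bound (I : finType) (P : I -> R -> Prop) :
  (forall i a b, a <= b -> P i a -> P i b) -> (forall i, exists a, P i a) ->
  exists2 a, 0 <= a & forall i, P i a.
Proof.
move=> Pmono /choice[f Pf]; exists (\sum_i `|f i|); first exact: sumr_ge0.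
move=> i; apply: Pmono (Pf i); rewrite (le_trans (ler_norm _))//.
by rewrite (bigD1 i)//= lerDl sumr_ge0.
Qed.

Lemma expr_unbounded (x y : R) : 1 < y -> exists n, x <= y ^+ n.
Proof.
move=> y1; pose n := (Num.truncn (x / (y - 1))).+1; exists n.
have bernoulli k : k%:R * (y - 1) <= y ^+ k.
  elim: k => [|k IH]; first by rewrite mul0r expr0.
  have yk : 1 <= y ^+ k by rewrite exprn_ege1// ltW.
  by rewrite exprS -natr1; nra.
apply: le_trans (bernoulli n).
by rewrite -ler_pdivrMr ?subr_gt0// ltW// truncnS_gt.
Qed.

End Bounds.

(** * Cancellation in sums of powers *)

Section Cancellation.
Variables (R : realType) (I : finType) (c : I -> R[i]) (lambda : R[i]).
Hypothesis lambda_gt1 : 1 < cabs lambda.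

Definition controlled (U : {set I}) (A : R) (k : I -> int) :=
  exists S : {set I}, [/\ S \subset U,
    \sum_(i in S) c i * lambda ^ k i = 0 &
    forall i, i \in U :\: S ->
      cabs lambda ^ k i <= A * cabs (\sum_(j in U) c j * lambda ^ k j)].

Lemma controlledW U A A' k : A <= A' -> controlled U A k -> controlled U A' k.
Proof.
move=> AA' [S [SU S0 SA]]; exists S; split=> // i /SA /le_trans; apply.
by rewrite ler_wpM2r// cabs_ge0.
Qed.

Let lambda_neq0 : lambda != 0.
Proof. by rewrite -cabs_gt0 (lt_trans _ lambda_gt1). Qed.

(** Strong induction on [#|U|]; inside it a cluster [T] grows, by induction on [#|U :\: T|]. The
    constant is chosen before [k]. *)
Lemma controlled_exponents (U : {set I}) :
  exists2 A : R, 0 <= A & forall k : I -> int, controlled U A k.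
Proof.
have [n] := ubnP #|U|; elim: n U => // n IHn U /ltnSE Un.
have [->|[i0 i0U]] := set_0Vmem U.
  exists 0 => // k; exists finset.set0; split; first exact: finset.sub0set.
    by rewrite big_set0.
  by move=> i; rewrite finset.set0D inE.
(* T collects exponents within M of the largest one; it grows until the
   remaining exponents are too small to compensate a nonzero sum over T. *)
suff cluster (T : {set I}) (M : nat) : T != finset.set0 -> T \subset U ->
    exists2 A : R, 0 <= A & forall (k : I -> int) (K : int),
      (forall i, i \in U -> k i <= K) ->
      (forall i, i \in T -> K - M%:Z <= k i) -> controlled U A k.
  (* The index of the largest exponent depends on [k], so one constant is taken that serves every
     candidate [i]. *)
  have [|i|A A0 Amax] := @uniform_bound R I (fun i A => i \in U ->
      forall k : I -> int, (forall j, j \in U -> k j <= k i) ->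
        controlled U A k).
  - by move=> i a b ab H iU k /(H iU); apply: controlledW.
  - have [iU|_] := boolP (i \in U); last by exists 0.
    have [||A _ HA] := cluster [set i] 0%N.
    + by apply/finset.set0Pn; exists i; rewrite inE.
    + by rewrite finset.sub1set.
    exists A => _ k /HA; apply=> j; rewrite inE => /eqP->.
    by rewrite subr0.
  exists A => // k; have [i iU imax] := arg_maxP k i0U.
  exact: Amax iU _ imax.
have [p] := ubnP #|U :\: T|; elim: p T M => // p IHp T M /ltnSE Tp T0 TU.
have UT : (#|U :\: T| < n)%N.
  apply: leq_trans Un; rewrite finset.cardsD (finset.setIidPr TU).
  by rewrite ltn_subrL card_gt0 T0 (cardD1 i0) i0U.
have [A0 A0_ge0 HA0] := IHn _ UT.
(* After division by [lambda ^ K] the cluster sum is one of the finitely many [v e]; [A1] bounds the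
   inverse moduli of the nonzero ones. *)
pose v (e : {ffun I -> 'I_M.+1}) := \sum_(i in T) c i * lambda ^ (- (e i)%:Z).
have [|e|A1 A1_ge0 HA1] := @uniform_bound R _
    (fun e A => v e != 0 -> 1 <= A * cabs (v e)).
- move=> e a b ab H /H /le_trans; apply.
  by rewrite ler_wpM2r// cabs_ge0.
- exists (cabs (v e))^-1; rewrite -cabs_gt0 => ve.
  by rewrite mulVf// gt_eqF.
pose G := \sum_i cabs (c i).
have G_ge0 : 0 <= G by apply: sumr_ge0 => i _; exact: cabs_ge0.
(* With this [M1], the terms of exponent at most [K - M1], multiplied by [2 * A1], total at most
   [cabs lambda ^ K]. *)
have [M1 HM1] := expr_unbounded (2 * A1 * G) lambda_gt1.
have [|i|A2 A2_ge0 HA2] := @uniform_bound R I (fun i A => i \in U :\: T ->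
    forall (k : I -> int) (K : int), (forall i, i \in U -> k i <= K) ->
      (forall j, j \in i |: T -> K - (M1 + M)%:Z <= k j) -> controlled U A k).
- move=> i a b ab H iU k K kU kT.
  by apply: controlledW ab _; exact: H kT.
- have [iUT|_] := boolP (i \in U :\: T); last by exists 0.
  move: (iUT); rewrite !inE => /andP[iT iU].
  have [|||A _ HA] := IHp (i |: T) (M1 + M)%N.
  + apply: leq_trans Tp; apply/proper_card/properP; split.
      by rewrite finset.setDS// finset.subsetUr.
    by exists i; rewrite // !inE eqxx.
  + by apply/finset.set0Pn; exists i; rewrite !inE eqxx.
  + by rewrite finset.subUset finset.sub1set iU.
  by exists A => _ k K; exact: HA.
exists (A0 + 2 * A1 + A2); first by rewrite !addr_ge0// mulr_ge0.
move=> k K kU kT.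
(* Three cases: an outside exponent is close enough to join the cluster; or the cluster sum vanishes
   and [T] is discarded along with a vanishing subsum of the rest; or the cluster dominates. *)
have [/existsP[i /andP[iUT iK]]|/existsPn far] :=
    boolP [exists i, (i \in U :\: T) && (K - (M1 + M)%:Z <= k i)].
  apply: (@controlledW _ A2); first by rewrite lerDr addr_ge0// mulr_ge0.
  apply: (HA2 i iUT k K kU) => j /finset.setU1P[->//|/kT].
  by apply: le_trans; rewrite lerD2l lerN2 lez_nat leq_addl.
have T_sum : \sum_(i in T) c i * lambda ^ k i =
    lambda ^ K * v [ffun i => inord `|K - k i|%N].
  rewrite mulr_sumr; apply: eq_bigr => i iT; rewrite mulrCA -expfzDr//.
  have Kk : 0 <= K - k i by rewrite subr_ge0 kU// (fintype.subsetP TU).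
  congr (_ * _ ^ _); rewrite ffunE inordK; first by rewrite gez0_abs// subKr.
  by rewrite ltnS -lez_nat gez0_abs// lerBlDr -lerBlDl kT.
set e := finfun _ in T_sum.
have U_sum : \sum_(i in U) c i * lambda ^ k i =
    lambda ^ K * v e + \sum_(i in U :\: T) c i * lambda ^ k i.
  by rewrite (big_setID T)/= (finset.setIidPr TU) T_sum.
have [ve0|ve_neq0] := eqVneq (v e) 0.
  apply: (@controlledW _ A0); first by rewrite -addrA lerDl addr_ge0// mulr_ge0.
  have [S [SUT S0 SA]] := HA0 k.
  have ST : [disjoint T & S].
    rewrite -finset.setI_eq0; apply/eqP/setP => i; rewrite !inE.
    by apply/andP => -[iT /(fintype.subsetP SUT)]; rewrite !inE iT.
  exists (T :|: S); split.
  - by rewrite finset.subUset TU (fintype.subset_trans SUT)// finset.subsetDl.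
  - rewrite (eq_bigl [predU T & S]) => [|i]; last by rewrite !inE.
    by rewrite bigU//= S0 T_sum ve0 mulr0 addr0.
  - by move=> i; rewrite -finset.setDDl U_sum ve0 mulr0 add0r; exact: SA.
apply: (@controlledW _ (2 * A1)); first by rewrite -addrA addrCA lerDl addr_ge0.
exists finset.set0; split; [exact: finset.sub0set|by rewrite big_set0|].
move=> i; rewrite finset.setD0 => iU.
have mu1 := ltW lambda_gt1.
apply: le_trans (ler_weXz2l mu1 (kU i iU)) _.
set s := \sum_(j in U :\: T) _ in U_sum.
have s_le : cabs s <= G * cabs lambda ^ (K - M1%:Z).
  apply: le_trans (cabs_sum _ _ _) _; rewrite mulr_suml.
  rewrite [leRHS](bigID (mem (U :\: T)))/= -[leLHS]addr0 lerD//; last first.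
    by apply: sumr_ge0 => j _; rewrite mulr_ge0 ?cabs_ge0 ?exprz_ge0 ?cabs_ge0.
  apply: ler_sum => j jUT; rewrite cabsM cabsXz ler_wpM2l ?cabs_ge0//.
  apply: ler_weXz2l => //; have := far j; rewrite jUT /= -ltNge => /ltW/le_trans.
  by apply; rewrite lerD2l lerN2 lez_nat leq_addr.
have muK : 0 < cabs lambda ^ K by rewrite exprz_gt0// (lt_trans _ lambda_gt1).
have small : 2 * A1 * cabs s <= cabs lambda ^ K.
  have -> : cabs lambda ^ K = cabs lambda ^+ M1 * cabs lambda ^ (K - M1%:Z).
    by rewrite exprnP -expfzDr ?gt_eqF ?(lt_trans _ lambda_gt1)// addrC subrK.
  have : 2 * A1 * cabs s <= 2 * A1 * (G * cabs lambda ^ (K - M1%:Z)).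
    by rewrite ler_wpM2l// mulr_ge0.
  by move/le_trans; apply; rewrite mulrA ler_wpM2r// exprz_ge0// cabs_ge0.
have lead : cabs lambda ^ K * cabs (v e) <= cabs (lambda ^ K * v e + s) + cabs s.
  rewrite -cabsXz -cabsM -{1}[lambda ^ K * v e](addrK s).
  exact: cabsB.
(* With x the modulus of [lambda ^ K] and u that of the whole sum: x <= A1 * (u + cabs s) <= A1 * u
   + x / 2. *)
rewrite U_sum; have := HA1 e ve_neq0; nra.
Qed.

End Cancellation.

(** * Separation and growth of polynomial values *)

Section Separation.
Variable R : realType.
Implicit Types P Q : {poly R[i]}.

Lemma lead_coef_MXaddC P (a : R[i]) : P != 0 ->
  lead_coef (P * 'X + a%:P) = lead_coef P.
Proof.
move=> P0; rewrite lead_coefDl ?lead_coefMX// size_mulX// ltnS.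
by rewrite (leq_trans (size_polyC_leq1 _))// size_poly_gt0.
Qed.

Lemma Re_horner_lead P : P != 0 ->
  exists n0, forall n, (n0 <= n)%N ->
    1 / 2 <= complex.Re (P.[n%:R] / lead_coef P).
Proof.
elim/poly_ind: P => [|P a IH]; first by rewrite eqxx.
have [->|P0 _] := eqVneq P 0.
  rewrite mul0r add0r polyC_eq0 => a0; exists 0%N => n _.
  by rewrite hornerC lead_coefC divff//=; lra.
have [n0 Hn0] := IH P0.
set b := lead_coef P in Hn0.
exists (maxn n0 (Num.truncn (1 - 2 * complex.Re (a / b))).+1) => n.
rewrite geq_max => /andP[/Hn0 Pn]; rewrite -(ler_nat R).
move=> /(lt_le_trans (truncnS_gt _)) na.
rewrite lead_coef_MXaddC// -/b hornerMXaddC.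
have -> : (P.[n%:R] * n%:R + a) / b = n%:R * (P.[n%:R] / b) + a / b by ring.
rewrite ReD Re_natM.
have : 0 <= n%:R :> R by [].
nra.
Qed.

(** Discrete product rule: for Q = P * X + a the increment is n * (P(n+1) - P(n)) + P(n+1). After
    division by the leading coefficient, the first part eventually has nonnegative real part and the
    second real part at least 1/2. *)
Lemma Re_horner_step Q : (1 < size Q)%N ->
  exists n0, forall n, (n0 <= n)%N ->
    1 / 2 <= complex.Re ((Q.[n.+1%:R] - Q.[n%:R]) / lead_coef Q).
Proof.
elim/poly_ind: Q => [|P a IH]; first by rewrite size_poly0.
have [->|P0 _] := eqVneq P 0.
  by rewrite mul0r add0r size_polyC; case: (_ == _).
have [n0 Hn0] := Re_horner_lead P0.
rewrite lead_coef_MXaddC//; set b := lead_coef P in Hn0 IH *.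
have [n1 Hn1] : exists n1, forall n, (n1 <= n)%N ->
    0 <= complex.Re ((P.[n.+1%:R] - P.[n%:R]) / b).
  have [/IH[n1 Hn1]|/size1_polyC->] := ltnP 1 (size P).
    by exists n1 => n /Hn1; apply: le_trans; lra.
  by exists 0%N => n _; rewrite !hornerC subrr mul0r.
exists (maxn n0 n1) => n; rewrite geq_max => /andP[/leqW/Hn0 Pn /Hn1 dP].
rewrite !hornerMXaddC.
have -> : (P.[n.+1%:R] * n.+1%:R + a - (P.[n%:R] * n%:R + a)) / b =
    n%:R * ((P.[n.+1%:R] - P.[n%:R]) / b) + P.[n.+1%:R] / b.
  by set q := P.[n.+1%:R]; rewrite -natr1; ring.
rewrite ReD Re_natM.
have : 0 <= n%:R :> R by [].
nra.
Qed.

Lemma horner_separated Q (b : R) : (1 < size Q)%N ->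
  exists L, forall x y, (L <= x)%N -> (x + L <= y)%N ->
    b < cabs (Q.[y%:R] - Q.[x%:R]).
Proof.
move=> Q1; have [n0 Hn0] := Re_horner_step Q1; set a := lead_coef Q in Hn0.
have a_gt0 : 0 < cabs a.
  by rewrite cabs_gt0 lead_coef_eq0 -size_poly_gt0 (ltn_trans _ Q1).
have drift x j : (n0 <= x)%N ->
    j%:R / 2 <= complex.Re ((Q.[(x + j)%:R] - Q.[x%:R]) / a).
  move=> n0x; elim: j => [|j IH]; first by rewrite addn0 subrr !mul0r.
  have := Hn0 _ (leq_trans n0x (leq_addr j x)).
  set d := _ / a => dj; rewrite addnS.
  have -> : (Q.[(x + j).+1%:R] - Q.[x%:R]) / a =
      d + (Q.[(x + j)%:R] - Q.[x%:R]) / a by rewrite /d; ring.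
  by rewrite ReD -natr1; lra.
pose L := maxn n0 (Num.truncn (2 * b / cabs a)).+1; exists L => x y.
rewrite geq_max => /andP[n0x _] xy.
(* Telescoping gives a drift of at least (y - x) / 2, and [L] exceeds [2 * b / cabs a]. *)
have := drift x (y - x)%N n0x; rewrite subnKC; last first.
  by rewrite (leq_trans _ xy)// leq_addr.
move=> /le_trans/(_ (Re_le_cabs _)); rewrite cabsM cabsV ler_pdivlMr//.
apply: lt_le_trans.
have : 2 * b / cabs a < (y - x)%:R.
  apply: lt_le_trans (truncnS_gt _) _; rewrite ler_nat.
  by apply: leq_trans (leq_maxr n0 _) _; rewrite -/L; move: (L) xy => l; lia.
by rewrite ltr_pdivrMr//; lra.
Qed.

(* Points of the same fibre lie in [0, L) or in one interval of length L, so
   a fibre is determined by its residues mod L and one bit. *)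
Lemma card_near_values Q (b : R) : (1 < size Q)%N ->
  exists D : nat, forall (T : finType) (t0 : T) (w : T -> R[i]) (X : set nat),
    finite_set X ->
    (forall n, X n -> exists t, cabs (Q.[n%:R] - w t) <= b) ->
    (#|` fset_set X| <= D * #|T|)%N.
Proof.
(* Two points near the same [w t] have values within [2 * b] of each other. *)
move=> Q1; have [L HL] := horner_separated (2 * b) Q1.
exists (2 * L.+1)%N => T t0 w X finX Xw.
have /choice[e He] n : exists t, X n -> cabs (Q.[n%:R] - w t) <= b.
  have [/Xw[t ?]|nX] := pselect (X n); first by exists t.
  by exists t0.
(* The modulus [L.+1] is positive even if [L] is 0, and distinct congruent points are still at least
   [L] apart. *)
pose code n := ((n < L)%N, inord (n %% L.+1) : 'I_L.+1, e n).
have code_inj : {in fset_set X &, injective code}.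
  have sym n p : X n -> X p -> code n = code p -> (n <= p)%N -> n = p.
    move=> Xn Xp [nLpL /(congr1 val)/=]; rewrite !inordK ?ltn_mod// => np enp lenp.
    have [nL|Ln] := ltnP n L.
      have pL : (p < L)%N by rewrite -nLpL.
      by move: np; rewrite !modn_small// ltnW.
    apply/eqP; rewrite eqn_leq lenp /= leqNgt; apply/negP => ltnp.
    have : (L.+1 %| p - n)%N by rewrite -eqn_mod_dvd// np.
    move/dvdn_leq; rewrite subn_gt0 => /(_ ltnp) Lpn.
    have /(HL n p Ln) : (n + L <= p)%N by lia.
    apply/negP; rewrite -leNgt.
    have -> : Q.[p%:R] - Q.[n%:R] =
        (Q.[p%:R] - w (e p)) - (Q.[n%:R] - w (e p)) by ring.
    apply: le_trans (cabsB _ _) _.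
    by have := He _ Xp; have := He _ Xn; rewrite enp; lra.
  move=> n p; rewrite !in_fset_set// !inE => Xn Xp np.
  by have [|/ltnW] := leqP n p; [exact: sym|move=> /sym->].
have /card_uniqP : uniq [seq code n | n <- fset_set X].
  by rewrite map_inj_in_uniq ?fset_uniq.
rewrite size_map => <-; apply: leq_trans (max_card _) _.
by rewrite !card_prod card_bool card_ord.
Qed.

Lemma horner_bounded Q : exists2 H : R, 0 <= H &
  forall (N : R) n, 1 <= N -> n%:R <= N -> cabs Q.[n%:R] <= H * N ^+ size Q.
Proof.
exists (\sum_(i < size Q) cabs Q`_i).
  by apply: sumr_ge0 => i _; exact: cabs_ge0.
move=> N n N1 nN; rewrite horner_coef mulr_suml.
apply: le_trans (cabs_sum _ _ _) _; apply: ler_sum => i _.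
rewrite cabsM cabsX cabs_nat ler_wpM2l ?cabs_ge0//.
apply: (@le_trans _ _ (N ^+ i)); first by rewrite lerXn2r ?nnegrE ?(le_trans ler01 N1).
by rewrite ler_weXn2l// ltnW.
Qed.

End Separation.

(** * Counting the integers near power sums *)

Section Counting.
Variables (R : realType) (m : nat) (c : 'I_m -> R[i]) (B : R).
Variable Q : {poly R[i]}.
Hypothesis Q_gt1 : (1 < size Q)%N.

Let ln2_gt0 : 0 < ln 2 :> R.
Proof. by rewrite ln_gt0// ltr1n. Qed.

Lemma near_power_sumV lambda n :
  near_power_sum c lambda^-1 B Q n -> near_power_sum c lambda B Q n.
Proof.
move=> [k Hk]; exists (fun i => - k i).
by under eq_bigr do rewrite -exprz_inv.
Qed.

(** All the sums lie in a disc of radius [G], so 0 is the only target value needed and the count is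
    bounded; [ln 2 <= ln N] turns this into the stated form. *)
Lemma near_power_sum_count_bounded lambda :
  (forall k : int, cabs (lambda ^ k) <= 1) ->
  exists C : R, 0 < C /\ forall N : R, 2 <= N ->
    (near_power_sum_count c lambda B Q N)%:R <= C * ln N ^+ m.
Proof.
move=> lambda1; pose G := \sum_i cabs (c i).
have [D HD] := card_near_values (B + G) Q_gt1.
exists (D%:R / ln 2 ^+ m + 1); split.
  by rewrite ltr_wpDl// divr_ge0// exprn_ge0// ltW.
move=> N N2; have N_gt0 : 0 < N by rewrite (lt_le_trans _ N2).
have lnN : ln 2 <= ln N by rewrite ler_ln ?posrE.
have lnN_ge0 : 0 <= ln N by rewrite (le_trans (ltW ln2_gt0)).
apply: (@le_trans _ _ D%:R).
  rewrite ler_nat -[D]muln1 -[1%N]card_unit.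
  apply: (HD unit tt (fun=> 0)); first exact: finite_near_power_sum_upto.
  move=> n [_ _ [k]]; rewrite cabs_le => Hk; exists tt; rewrite subr0.
  rewrite -[Q.[_]](subrK (\sum_i c i * lambda ^ k i)).
  apply: le_trans (cabsD _ _) _; rewrite lerD//.
  apply: le_trans (cabs_sum _ _ _) _; apply: ler_sum => i _.
  by rewrite cabsM ler_piMr// cabs_ge0.
rewrite mulrDl mul1r -mulrA -[leLHS]addr0 lerD ?exprn_ge0//.
rewrite ler_peMr// mulrC -expr_div_n.
by rewrite exprn_ege1// ler_pdivlMr// mul1r.
Qed.

(* The code of n replaces by 0 the exponents of a vanishing subsum and the
   negative ones (which only contribute a bounded amount), and shifts the
   others by one. *)
Lemma near_power_sum_count_gt1 lambda : 1 < cabs lambda ->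
  exists C : R, 0 < C /\ forall N : R, 2 <= N ->
    (near_power_sum_count c lambda B Q N)%:R <= C * ln N ^+ m.
Proof.
move=> lambda1; pose G := \sum_i cabs (c i).
have [D HD] := card_near_values (`|B| + G) Q_gt1.
have [A A_ge0 HA] := controlled_exponents c lambda1 [set: 'I_m]%SET.
have [H H_ge0 HH] := horner_bounded Q.
(* Chosen so that [cabs lambda ^+ j <= E * N ^+ size Q] forces [j <= r * ln N]; the constant [ln E]
   is absorbed using [ln 2 <= ln N]. *)
pose E := A * (`|B| + H) + 1; pose F := ln E / ln 2 + (size Q)%:R.
pose r := F / ln (cabs lambda).
have E1 : 1 <= E by rewrite lerDr mulr_ge0// addr_ge0.
have F_ge0 : 0 <= F by rewrite addr_ge0// divr_ge0 ?(ln_ge0 E1) ?(ltW ln2_gt0).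
have r_ge0 : 0 <= r by rewrite divr_ge0 ?(ln_ge0 (ltW lambda1)).
have r2_ge0 : 0 <= r + 2 / ln 2 by rewrite addr_ge0// divr_ge0// ltW.
(* For N >= 2 the number [K.+2] of code letters is at most [(r + 2 / ln 2) * ln N]. *)
exists (D%:R * (r + 2 / ln 2) ^+ m + 1); split.
  by rewrite ltr_wpDl// mulr_ge0// exprn_ge0.
move=> N N2; have N_gt0 : 0 < N by rewrite (lt_le_trans _ N2).
have N1 : 1 <= N by rewrite (le_trans _ N2)// ler1n.
have lnN : ln 2 <= ln N by rewrite ler_ln ?posrE.
have lnN_ge0 : 0 <= ln N by rewrite (le_trans (ltW ln2_gt0)).
pose K := Num.truncn (r * ln N).
pose w (e : {ffun 'I_m -> 'I_K.+2}) :=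
  \sum_(i | (e i != 0 :> nat)) c i * lambda ^ (e i).-1%:Z.
have exp_le (j : nat) : cabs lambda ^+ j <= E * N ^+ size Q -> (j <= K)%N.
  rewrite truncn_ge_nat ?(mulr_ge0 r_ge0)// => jE.
  have ln_lambda : 0 < ln (cabs lambda) by rewrite ln_gt0.
  have lambda_gt0 : 0 < cabs lambda by rewrite (lt_trans _ lambda1).
  have E_gt0 : 0 < E by rewrite (lt_le_trans _ E1).
  move: jE; rewrite -ler_ln ?posrE ?mulr_gt0 ?exprn_gt0//.
  rewrite lnM ?posrE ?exprn_gt0// (lnXn j lambda_gt0) (lnXn (size Q) N_gt0).
  rewrite -[leLHS]mulr_natl -[X in _ <= _ + X]mulr_natl => jE.
  rewrite /r mulrAC ler_pdivlMr//; apply: le_trans jE _.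
  by rewrite /F mulrDl lerD2r mulrAC ler_pdivlMr// ler_wpM2l// ln_ge0.
have : (near_power_sum_count c lambda B Q N <= D * K.+2 ^ m)%N.
  have -> : (K.+2 ^ m = #|{ffun 'I_m -> 'I_K.+2}|)%N by rewrite card_ffun !card_ord.
  apply: (HD _ [ffun=> ord0] w); first exact: finite_near_power_sum_upto.
  move=> n [_ nN [k]]; rewrite cabs_le => Hk.
  have [S [_ S0 SA]] := HA k.
  have sum_setT : \sum_(i in [set: 'I_m]%SET) c i * lambda ^ k i =
      \sum_i c i * lambda ^ k i by apply: eq_bigl => i; rewrite inE.
  rewrite sum_setT in SA; set s := \sum_i _ in SA Hk.
  have s_le : cabs s <= (`|B| + H) * N ^+ size Q.
    rewrite -[s](subKr Q.[n%:R]); apply: le_trans (cabsB _ _) _.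
    rewrite mulrDl addrC lerD ?HH//.
    by rewrite (le_trans Hk)// (le_trans (ler_norm B))// ler_peMr// exprn_ege1.
  have k_le i (j : nat) : i \notin S -> k i = j -> (j <= K)%N.
    move=> iS kij; apply: exp_le; rewrite exprnP -kij.
    apply: le_trans (SA i _) _; first by rewrite !inE iS.
    apply: le_trans (ler_wpM2l A_ge0 s_le) _.
    by rewrite mulrA ler_wpM2r ?exprn_ge0 ?lerDl// ltW.
  pose e : {ffun 'I_m -> 'I_K.+2} := [ffun i => if i \in S then ord0 else
    if k i is Posz j then inord j.+1 else ord0].
  exists e.
  have sE : s = w e + \sum_(i | (i \notin S) && (k i < 0)) c i * lambda ^ k i.
    rewrite /s (bigID (mem S))/= S0 add0r (bigID (fun i => k i < 0))/= addrC.
    congr (_ + _); apply: eq_big => [i|i /andP[iS]]; rewrite ffunE.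
      case: ifP => //= iS; case ki: (k i) => [j|j]//=.
      by rewrite inordK// !ltnS (k_le i)// iS.
    rewrite (negbTE iS); case ki: (k i) => [j|j]//= _.
    by rewrite inordK// !ltnS (k_le i).
  (* Each remaining negative power has modulus at most 1, so these terms cost at most [G]. *)
  have -> : Q.[n%:R] - w e = (Q.[n%:R] - s) +
      \sum_(i | (i \notin S) && (k i < 0)) c i * lambda ^ k i.
    by rewrite sE; ring.
  apply: le_trans (cabsD _ _) _; rewrite lerD ?(le_trans Hk) ?ler_norm//.
  apply: le_trans (cabs_sum _ _ _) _.
  rewrite [leRHS](bigID (fun i => (i \notin S) && (k i < 0)))/= -[leLHS]addr0.
  rewrite lerD ?sumr_ge0// => [|i _]; last exact: cabs_ge0.
  apply: ler_sum => i /andP[_ ki]; rewrite cabsM ler_piMr ?cabs_ge0//.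
  by rewrite cabsXz -(expr0z (cabs lambda)) ler_weXz2l// ltW.
rewrite -(ler_nat R) natrM natrX => /le_trans; apply.
rewrite mulrDl mul1r -[leLHS]addr0 lerD ?exprn_ge0// -mulrA ler_wpM2l//.
rewrite -exprMn lerXn2r// ?nnegrE ?mulr_ge0//.
have := truncn_le (r * ln N); rewrite (mulr_ge0 r_ge0)// -/K => KN.
have : 2 <= 2 / ln 2 * ln N by rewrite mulrAC ler_pdivlMr// ler_wpM2l.
by rewrite -[K.+2%:R]natr1 -natr1 mulrDl; lra.
Qed.

End Counting.

(** * Case analysis on the modulus of lambda *)

Theorem theorem1p1 (R : realType) (m : nat) (hm : (1 <= m)%N)
    (c : 'I_m -> R[i]) (lambda : R[i]) (B : R)
    (Q : {poly R[i]}) (hQ : (1 < size Q)%N) :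
  exists C : R, 0 < C /\
    forall N : R, 2 <= N ->
      (near_power_sum_count c lambda B Q N)%:R <= C * ln N ^+ m.
Proof.
have [->|lambda0] := eqVneq lambda 0.
  apply: near_power_sum_count_bounded => // k.
  by rewrite exp0rz; case: eqP; rewrite ?cabs1 ?cabs0.
have [lt1|gt1|eq1] := ltgtP (cabs lambda) 1.
- have [|C [C_gt0 HC]] :=
      @near_power_sum_count_gt1 R m c B Q hQ lambda^-1.
    by rewrite cabsV invf_gt1// cabs_gt0.
  exists C; split=> [|N N2]; first exact: C_gt0.
  apply: le_trans (HC N N2); rewrite ler_nat /near_power_sum_count.
  apply: fsubset_leq_card.
  rewrite -fset_set_sub; [|exact: finite_near_power_sum_upto..].
  move=> n [n0 nN nlambda]; split; [exact: n0|exact: nN|].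
  by apply: near_power_sumV; rewrite invrK.
- exact: near_power_sum_count_gt1.
- by apply: near_power_sum_count_bounded => // k; rewrite cabsXz eq1 exp1rz.
Qed.
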